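(* Let $A=\{x_1,x_2\}$ be an alphabet of two variables and let $x$ be a further variable. For every positive integer $n$, $$\sum_{k=0}^{n}\binom{n}{k}(x_1-x_2)^{n-k}\left(2^k\phi_k(x_1+x_2)+2(x_1+x_2)^k\right)G_{n-k}(x)=2n(x_1-x_2)\left(\bigl(x_1+x_2+x(x_1-x_2)\bigr)^{n-1}+\bigl(2x_2+x(x_1-x_2)\bigr)^{n-1}\right).$$
   Context: Here $x_1,x_2,x$ are commuting variables (indeterminates) and identities are in the field of rational functions in them. The notation $\phi_n(x_1+x_2)$ denotes the function of the alphabet $\{x_1,x_2\}$ (not of the sum) given by $\phi_n(x_1+x_2)=x_1^n+x_2^n$ for $n\ge 0$; the expression $(x_1+x_2)^k$ is the ordinary power of the sum. The Genocchi polynomials $G_n(x)$ are defined by $\sum_{n\ge 0}G_n(x)\frac{z^n}{n!}=\frac{2ze^{xz}}{e^z+1}$. *)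

(* Defs.v *)
From HB Require Import structures.
From mathcomp Require Import all_boot all_order all_algebra.
From mathcomp Require Import fraction.
From mathcomp Require Import mpoly.
Set Implicit Arguments.
Unset Strict Implicit.
Unset Printing Implicit Defensive.
Import GRing.Theory.
Local Open Scope ring_scope.

(* A formal power series in z is given by its coefficients. *)
Definition fps (R : comUnitRingType) : Type := nat -> R.

Section FormalPowerSeries.
Variable R : comUnitRingType.
Implicit Types f g : fps R.

Definition fps_const (c : R) : fps R := fun n => c *+ (n == 0).
Definition fps_z : fps R := fun n => (n == 1)%:R.
Definition fps_add f g : fps R := fun n => f n + g n.
Definition fps_mul f g : fps R := fun n => \sum_(i < n.+1) f i * g (n - i)%N.
Definition fps_exp (a : R) : fps R := fun n => a ^+ n / n`!%:R.

(* The first n coefficients of the multiplicative inverse of f, obtained by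
   solving f * g = 1 degree by degree; meaningful when f 0 is a unit. *)
Fixpoint fps_inv_coefs f n : seq R :=
  if n is m.+1 then
    let s := fps_inv_coefs f m in
    rcons s ((f 0)^-1 * ((m == 0)%:R - \sum_(i < m) f (m - i)%N * s`_i))
  else [::].
Definition fps_inv f : fps R := fun n => (fps_inv_coefs f n.+1)`_n.
Definition fps_div f g : fps R := fps_mul f (fps_inv g).

Lemma size_fps_inv_coefs f n : size (fps_inv_coefs f n) = n.
Proof. by elim: n => //= n IHn; rewrite size_rcons IHn. Qed.

Lemma nth_fps_inv_coefs f n i :
  (i < n)%N -> (fps_inv_coefs f n)`_i = fps_inv f i.
Proof.
elim: n => // n IHn; rewrite ltnS leq_eqVlt => /orP[/eqP-> // | lt_in].
by rewrite /= nth_rcons size_fps_inv_coefs lt_in IHn.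
Qed.

Lemma fps_invE f n :
  fps_inv f n =
  (f 0)^-1 * ((n == 0)%:R - \sum_(i < n) f (n - i)%N * fps_inv f i).
Proof.
rewrite {1}/fps_inv /= nth_rcons size_fps_inv_coefs ltnn eqxx.
by congr (_ * (_ - _)); apply: eq_bigr => i _; rewrite nth_fps_inv_coefs.
Qed.

Lemma fps_mulVf f : f 0 \is a GRing.unit ->
  fps_mul (fps_inv f) f =1 fps_const 1.
Proof.
move=> Uf n; rewrite /fps_mul big_ord_recr /= subnn mulrC fps_invE mulVKr //.
by rewrite (eq_bigr _ (fun i _ => mulrC _ _)) addrC subrK.
Qed.

End FormalPowerSeries.

(* The egf is divided in K[x][[z]]: factorials, and the constant term 2 of
   e^z + 1, are units of K[x] when K has characteristic 0. *)
Definition genocchi_egf (K : fieldType) : fps {poly K} :=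
  fps_div (fps_mul (fps_mul (fps_const 2) (fps_z _)) (fps_exp 'X))
          (fps_add (fps_exp 1) (fps_const 1)).

Definition genocchi (K : fieldType) (n : nat) : {poly K} :=
  n`!%:R * genocchi_egf K n.

Definition ratfun3 (F : fieldType) : fieldType := {fraction {mpoly F[3]}}.
Definition indet (F : fieldType) (i : 'I_3) : ratfun3 F := tofrac 'X_i.

(* phi_n of the two-letter alphabet a + b; phi 0 a b = 2. *)
Definition phi (K : fieldType) (n : nat) (a b : K) : K := a ^+ n + b ^+ n.

(* Main.v *)
Require Import Defs.
From HB Require Import structures.
From mathcomp Require Import all_boot all_order all_algebra.
From mathcomp Require Import fraction.
From mathcomp Require Import mpoly.
From mathcomp Require Import ring.
Set Implicit Arguments.
Unset Strict Implicit.
Unset Printing Implicit Defensive.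
Import GRing.Theory.
Local Open Scope ring_scope.

(** Umbral argument. Let [L] be the linear functional on polynomials in ['X]
    sending ['X^i] to [G_i(x)]. The equation [(e^z + 1) G(z) = 2 z e^(xz)] for
    the generating function says [L (p ('X + 1)) + L p = 2 p'(x)] for every [p].
    With [d = x1 - x2], [q = (d 'X + 2 x2)^n] and [r = (d 'X + x1 + x2)^n] one
    has [q ('X + 1) = r] and [r ('X + 1) = (d 'X + 2 x1)^n], so the left-hand
    side [L (r ('X + 1) + q + 2 r)] equals [2 r'(x) + 2 q'(x)]. *)

Section FormalPowerSeriesTheory.
Variable R : comUnitRingType.
Implicit Types f g h : fps R.

(** Truncation lets power series inherit ring laws from [{poly R}], here associativity. *)
Lemma fps_mul_poly f g N n : (n < N)%N ->
  fps_mul f g n = (\poly_(i < N) f i * \poly_(i < N) g i)`_n.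
Proof.
move=> lt_nN; rewrite coefM; apply: eq_bigr => i _; rewrite !coef_poly.
rewrite (leq_ltn_trans _ lt_nN) ?(leq_ltn_trans (leq_subr _ _) lt_nN) //.
by rewrite -ltnS.
Qed.

Lemma fps_mulA f g h : fps_mul f (fps_mul g h) =1 fps_mul (fps_mul f g) h.
Proof.
move=> n; pose P k := \poly_(i < n.+1) (k : fps R) i.
transitivity ((P f * (P g * P h))`_n); last rewrite mulrA.
  rewrite coefM; apply: eq_bigr => i _; rewrite coef_poly ltn_ord.
  by rewrite (@fps_mul_poly _ _ n.+1) // ltnS leq_subr.
rewrite coefM; apply: eq_bigr => i _; rewrite coef_poly ltnS leq_subr.
by rewrite (@fps_mul_poly _ _ n.+1).
Qed.

Lemma eq_fps_mulr f g h : g =1 h -> fps_mul f g =1 fps_mul f h.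
Proof. by move=> eq_gh n; apply: eq_bigr => i _; rewrite eq_gh. Qed.

Lemma fps_mul1r f : fps_mul f (fps_const 1) =1 f.
Proof.
move=> n; rewrite /fps_mul big_ord_recr /= subnn /fps_const mulr1n mulr1.
rewrite big1 ?add0r // => i _.
by rewrite subn_eq0 leqNgt ltn_ord mulr0n mulr0.
Qed.

Lemma fps_divK f g : g 0%N \is a GRing.unit -> fps_mul (fps_div f g) g =1 f.
Proof.
move=> Ug n; rewrite -fps_mulA (eq_fps_mulr _ (fps_mulVf Ug)).
exact: fps_mul1r.
Qed.

End FormalPowerSeriesTheory.

Section Umbral.
Variables (R : comNzRingType) (a : nat -> R).
Implicit Types p q : {poly R}.

Definition umbral p : R := \sum_(i < size p) p`_i * a i.

Lemma umbral_widen p N :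
  (size p <= N)%N -> umbral p = \sum_(i < N) p`_i * a i.
Proof.
move=> le_pN; rewrite /umbral (big_ord_widen N (fun i => p`_i * a i)) //.
rewrite [RHS](bigID (fun i : 'I_N => i < size p)%N) /=.
rewrite [X in _ = _ + X]big1 ?addr0 // => i; rewrite -leqNgt => le_pi.
by rewrite nth_default ?mul0r.
Qed.

Lemma umbral_is_linear : linear_for *%R umbral.
Proof.
move=> c p q; pose N := maxn (size (c *: p + q)) (maxn (size p) (size q)).
rewrite !(@umbral_widen _ N) ?leq_max ?leqnn ?orbT // mulr_sumr -big_split /=.
by apply: eq_bigr => i _; rewrite coefD coefZ mulrDl mulrA.
Qed.

HB.instance Definition _ :=
  GRing.isLinear.Build R {poly R} R *%R umbral umbral_is_linear.

Lemma umbralXn n : umbral 'X^n = a n.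
Proof.
rewrite /umbral size_polyXn big_ord_recr /= coefXn eqxx mul1r big1 ?add0r //.
by move=> i _; rewrite coefXn ltn_eqF // mul0r.
Qed.

(** Taking [k] as the exponent of [c] leaves the moment [a (n - k)], the shape of the sum in the
    theorem. *)
Lemma umbral_binomial c d n :
  umbral ((d *: 'X + c%:P) ^+ n) =
  \sum_(k < n.+1) 'C(n, k)%:R * d ^+ (n - k) * c ^+ k * a (n - k)%N.
Proof.
rewrite exprDn linear_sum; apply: eq_bigr => k _ /=.
rewrite -polyC_exp exprZn mulrC mul_polyC scalerA -scaler_nat scalerA.
by rewrite linearZ /= umbralXn; ring.
Qed.

End Umbral.

Section Genocchi.
Variable K : fieldType.
Hypothesis charK : [pchar K] =i pred0.

Lemma poly_natr_unit n : (0 < n)%N -> (n%:R : {poly K}) \is a GRing.unit.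
Proof.
move=> n_gt0; rewrite -polyC_natr poly_unitE size_polyC coefC eqxx unitfE.
have nz : n%:R != 0 :> K by rewrite ((pcharf0P K).1 charK) -lt0n.
by rewrite nz.
Qed.

(** Converts the factor n!/(n-i)!, produced by the coefficients of e^z, into binomial form. *)
Lemma bin_fact_poly n i : (i <= n)%N ->
  n`!%:R / (n - i)`!%:R = 'C(n, i)%:R * i`!%:R :> {poly K}.
Proof.
move=> le_in; apply: (mulIr (poly_natr_unit (fact_gt0 (n - i)))).
rewrite divrK ?poly_natr_unit ?fact_gt0 //.
by rewrite -(bin_fact le_in) !natrM mulrA.
Qed.

(** Compares the coefficients of z^n, times n!, in (e^z + 1) G(z) = 2 z e^(xz). *)
Lemma genocchi_rec n :
  \sum_(i < n.+1) 'C(n, i)%:R * genocchi K i + genocchi K n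
  = 2 * n%:R * 'X^(n.-1).
Proof.
set D := fps_add (fps_exp 1) (fps_const (1 : {poly K})).
have UD : D 0%N \is a GRing.unit.
  rewrite /D /fps_add /fps_exp /fps_const fact0 divr1 -(natrD _ 1 1).
  exact: poly_natr_unit.
have /(congr1 (fun p => n`!%:R * p)) := fps_divK
  (fps_mul (fps_mul (fps_const 2) (@fps_z _)) (fps_exp 'X)) UD n.
rewrite -/(genocchi_egf K) => eqG; transitivity
  (n`!%:R * fps_mul (genocchi_egf K) D n).
  rewrite /fps_mul mulr_sumr.
  under [RHS]eq_bigr => i _.
    rewrite /D /fps_add /fps_exp expr1n !mulrDr mul1r mulrCA bin_fact_poly.
      over.
    by rewrite -ltnS.
  (* The e^z part of [D] yields the binomial sum, the constant series 1 the lone [genocchi K n]. *)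
  rewrite big_split /=; congr (_ + _).
    by apply: eq_bigr => i _; rewrite /genocchi; ring.
  by rewrite -mulr_sumr [X in _ * X]fps_mul1r.
rewrite {}eqG; set M := fps_mul (fps_const 2) _.
have mul2z i : M i = 2 *+ (i == 1).
  rewrite /M /fps_mul big_ord_recl big1 => [|j _]; last first.
    by rewrite /fps_const mulr0n mul0r.
  by rewrite /fps_const /fps_z subn0 addr0 mulr1n mulr_natr.
rewrite /fps_mul; case: n => [|n].
  by rewrite big_ord1 mul2z !(mul0r, mulr0).
(* Only degree 1 of the series 2z contributes, leaving (n+1)! * 2 * 'X^n / n!. *)
rewrite 2!big_ord_recl big1 => [|j _]; last by rewrite mul2z mul0r.
rewrite !mul2z mul0r add0r addr0 /fps_exp /= mulr1n subn1 /=.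
have := @bin_fact_poly n.+1 1 isT; rewrite bin1 (factS 0) fact0 mulr1 subn1 /= => <-.
by ring.
Qed.

Variable x : K.
Let L := umbral (fun i => (genocchi K i).[x]).

(** By linearity [p] may be taken to be ['X^i]; the identity is then [genocchi_rec] evaluated at
    [x]. *)
Lemma umbral_genocchi_shift p : L (p \Po ('X + 1)) + L p = 2 * p^`().[x].
Proof.
rewrite /L -[p]coefK poly_def !linear_sum /= horner_sum mulr_sumr -big_split.
apply: eq_bigr => i _ /=; rewrite comp_polyZ !linearZ /= hornerZ.
rewrite comp_Xn_poly derivXn hornerMn hornerXn -[X in (X + 1) ^+ _](scale1r 'X).
rewrite umbral_binomial umbralXn mulrCA -mulrDr; congr (_ * _).
have /(congr1 (horner^~ x)) := genocchi_rec i.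
rewrite -natrM mulr_natl hornerMn hornerXn hornerD horner_sum.
rewrite mulnC mulrnA => rec_x; rewrite [RHS]mulr_natl -rec_x.
(* The expansion of ('X + 1)^i carries G_(i-j) and the recurrence G_j, so the sum is reversed. *)
congr (_ + _); rewrite (reindex_inj rev_ord_inj); apply: eq_bigr => j _ /=.
have le_ji : (j <= i)%N by rewrite -ltnS.
rewrite subSS (subKn le_ji) (bin_sub le_ji) !expr1n !mulr1.
by rewrite !mulr_natl hornerMn.
Qed.

Lemma genocchi_convolution (x1 x2 : K) n :
  \sum_(k < n.+1)
     'C(n, k)%:R * (x1 - x2) ^+ (n - k)
       * (2 ^+ k * phi k x1 x2 + 2 * (x1 + x2) ^+ k)
       * (genocchi K (n - k)).[x]
  = 2 * n%:R * (x1 - x2)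
      * ((x1 + x2 + x * (x1 - x2)) ^+ n.-1
         + (2 * x2 + x * (x1 - x2)) ^+ n.-1).
Proof.
(* The constants 2 x2, x1 + x2, 2 x1 are in arithmetic progression with difference [d], so each
   shift by 1 moves [B] to the next one. *)
set d := x1 - x2; pose B (c : K) := (d *: 'X + c%:P) ^+ n.
have shiftB c : B c \Po ('X + 1) = B (c + d).
  rewrite /B rmorphXn /= comp_polyD comp_polyZ comp_polyX comp_polyC.
  by rewrite polyCD scalerDr alg_polyC addrAC -addrA.
have derivB c : (B c)^`().[x] = n%:R * d * (c + x * d) ^+ n.-1.
  rewrite /B deriv_exp derivD derivZ derivX derivC addr0.
  rewrite hornerMn !hornerE /= -mulr_natl mulrA.
  by rewrite [_ + c]addrC [d * x]mulrC.
have Br : B (2 * x2) \Po ('X + 1) = B (x1 + x2).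
  by rewrite shiftB; congr (B _); rewrite /d; ring.
have Bl : B (x1 + x2) \Po ('X + 1) = B (2 * x1).
  by rewrite shiftB; congr (B _); rewrite /d; ring.
(* Here 2^k phi_k splits as (2 x1)^k + (2 x2)^k, and each copy of (x1 + x2)^k joins one of these to
   form a shift pair. *)
transitivity (L (B (2 * x1)) + L (B (x1 + x2)) +
              (L (B (x1 + x2)) + L (B (2 * x2)))).
  rewrite /L /B !umbral_binomial -!big_split /=; apply: eq_bigr => k _ /=.
  by rewrite /phi !exprMn; ring.
(* The last [Br] restores the [B (x1 + x2)] inside the first derivative, which [-Br] also
   rewrote. *)
rewrite -Bl umbral_genocchi_shift -Br umbral_genocchi_shift Br.
by rewrite !derivB; ring.
Qed.

End Genocchi.

(** The embeddings of F into its polynomial ring and of that ring into its fractions are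
    injective. *)
Lemma pchar_ratfun3 (F : fieldType) :
  [pchar F] =i pred0 -> [pchar ratfun3 F] =i pred0.
Proof.
move=> charF p; rewrite -(charF p) -(pchar_lalg {mpoly F[3]}) !inE.
by rewrite -(rmorph_nat (@tofrac {mpoly F[3]})) tofrac_eq0.
Qed.

Theorem theorem10 (F : fieldType) (charF : [pchar F] =i pred0)
    (n : nat) (n_gt0 : (0 < n)%N) :
  let x1 := indet F 0 in
  let x2 := indet F 1 in
  let x := indet F 2 in
  \sum_(k < n.+1)
     'C(n, k)%:R * (x1 - x2) ^+ (n - k)
       * (2 ^+ k * phi k x1 x2 + 2 * (x1 + x2) ^+ k)
       * (genocchi (ratfun3 F) (n - k)).[x]
  = 2 * n%:R * (x1 - x2)
      * ((x1 + x2 + x * (x1 - x2)) ^+ n.-1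
         + (2 * x2 + x * (x1 - x2)) ^+ n.-1).
Proof. exact: genocchi_convolution (pchar_ratfun3 charF) _ _ _ _. Qed.
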